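(* Let $\mathcal{N},\mathcal{M},\mathcal{L}$ be $C^1$ manifolds of dimensions $m,n,l$, respectively, let $F:\mathcal{N}\rightsquigarrow\mathcal{M}$ and $G:\mathcal{M}\rightsquigarrow\mathcal{L}$ be set-valued maps, and consider the composition $G\circ F:\mathcal{N}\rightsquigarrow\mathcal{L}$, $(G\circ F)(x)=\bigcup_{y\in F(x)}G(y)$. Let $\bar x\in\mathcal{N}$, $\bar y\in\mathcal{M}$, $\bar z\in\mathcal{L}$, $\Gamma_F\subseteq\mathcal{N}$. Assume that $\Lambda_F$ is a QDQ of $F$ at $(\bar x,\bar y)$ in the direction of $\Gamma_F$ and that $\Lambda_G$ is a QDQ of $G$ at $(\bar y,\bar z)$ in the direction of a set $\Gamma_G\subseteq\mathcal{M}$ containing $F(\Gamma_F)=\bigcup_{x\in\Gamma_F}F(x)$. Then the set $$\Lambda:=\Lambda_G\circ\Lambda_F=\{L''\circ L' : L''\in\Lambda_G,\ L'\in\Lambda_F\}$$ is a QDQ of $G\circ F$ at $(\bar x,\bar z)$ in the direction of $\Gamma_F$.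
   Context: Notation: $\rightsquigarrow$ denotes a set-valued map; $\mathrm{Lin}(V,W)$ is the space of linear maps $V\to W$; $B_\delta$ is the ball of radius $\delta$ centered at $0$ (taking open or closed balls gives equivalent definitions); $d(\cdot,\Lambda)$ is the distance to $\Lambda$ for a norm on $\mathrm{Lin}(\mathbb{R}^n,\mathbb{R}^m)$. A modulus is a non-decreasing function $\rho:[0,+\infty)\to[0,+\infty)$ with $\lim_{\delta\to0^+}\rho(\delta)=0$. Definition (QDQ, Euclidean case). Let $F:\mathbb{R}^n\rightsquigarrow\mathbb{R}^m$ be a set-valued map, $(\bar x,\bar y)\in\mathbb{R}^n\times\mathbb{R}^m$, $\Lambda\subset\mathrm{Lin}(\mathbb{R}^n,\mathbb{R}^m)$ a compact set, and $\Gamma\subseteq\mathbb{R}^n$ any subset. $\Lambda$ is a Quasi Differential Quotient (QDQ) of $F$ at $(\bar x,\bar y)$ in the direction of $\Gamma$ if there exist $\delta^*\in(0,+\infty]$ and a modulus $\rho$ such that for every $\delta\in(0,\delta^* )$ there is a continuous map $(L_\delta,h_\delta):(\bar x+B_\delta)\cap\Gamma\to\mathrm{Lin}(\mathbb{R}^n,\mathbb{R}^m)\times\mathbb{R}^m$ such that, for all $x\in(\bar x+B_\delta)\cap\Gamma$, $$d(L_\delta(x),\Lambda)\le\rho(\delta),\qquad |h_\delta(x)|\le\delta\rho(\delta),\qquad \bar y+L_\delta(x)\cdot(x-\bar x)+h_\delta(x)\in F(x).$$ Definition (QDQ on manifolds). Let $\mathcal{X},\mathcal{Y}$ be $C^1$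 manifolds of dimensions $p,q$, $\tilde G:\mathcal{X}\rightsquigarrow\mathcal{Y}$ a set-valued map, $(\bar x,\bar y)\in\mathcal{X}\times\mathcal{Y}$, $\tilde\Lambda\subset\mathrm{Lin}(T_{\bar x}\mathcal{X},T_{\bar y}\mathcal{Y})$ compact, $\tilde\Gamma\subseteq\mathcal{X}$ any subset. Let $\phi:U\to\mathbb{R}^p$, $\psi:V\to\mathbb{R}^q$ be charts on neighborhoods of $\bar x$, $\bar y$ with $\phi(\bar x)=0$, $\psi(\bar y)=0$, and let $\hat G:=\psi\circ\tilde G\circ\phi^{-1}$ on $\phi(U)$, extended arbitrarily to a set-valued map $\mathbb{R}^p\rightsquigarrow\mathbb{R}^q$. $\tilde\Lambda$ is a QDQ of $\tilde G$ at $(\bar x,\bar y)$ in the direction of $\tilde\Gamma$ if $D\psi(\bar y)\circ\tilde\Lambda\circ D\phi^{-1}(0)$ is a QDQ of $\hat G$ at $(0,0)$ in the direction of $\phi(\tilde\Gamma\cap U)$. (This notion does not depend on the choice of charts.) *)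

(* Defs.v *)
From HB Require Import structures.
From mathcomp Require Import all_boot all_order all_algebra.
From mathcomp Require Import all_classical all_reals all_analysis.

Set Implicit Arguments.
Unset Strict Implicit.
Unset Printing Implicit Defensive.

Import Order.TTheory GRing.Theory Num.Theory.
Import numFieldNormedType.Exports.

Local Open Scope classical_set_scope.
Local Open Scope ring_scope.

(* Elements of R^n are row vectors; Lin(R^n, R^m) is 'M[R]_(n, m), a matrix M
   acting by u |-> u *m M (as 'J does), with its library (max-entry) norm. *)

Definition enorm (R : realType) (n : nat) (u : 'rV[R]_n) : R :=
  Num.sqrt (\sum_(i < n) u 0 i ^+ 2).

(* A modulus is a function on [0, +oo[: its values at negative arguments are
   irrelevant. *)
Definition modulus (R : realType) (rho : R -> R) : Prop :=
  [/\ forall s, 0 <= s -> 0 <= rho s,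
      forall s t, 0 <= s -> s <= t -> rho s <= rho t &
      rho s @[s --> 0^'+] --> 0].

(* The distance to Lam is the extended-real [edist_inf], which is +oo when Lam
   is empty. L and h are total functions of which only the restriction to D
   matters. *)
Definition QDQ (R : realType) (n m : nat) (F : 'rV[R]_n -> set 'rV[R]_m)
    (x0 : 'rV[R]_n) (y0 : 'rV[R]_m) (Lam : set 'M[R]_(n, m))
    (Gam : set 'rV[R]_n) : Prop :=
  compact Lam /\
  exists (dstar : \bar R) (rho : R -> R),
    [/\ (0 < dstar)%E, modulus rho &
      forall delta : R, 0 < delta -> (delta%:E < dstar)%E ->
      let D := [set x | enorm (x - x0) < delta] `&` Gam in
      exists (L : 'rV[R]_n -> 'M[R]_(n, m)) (h : 'rV[R]_n -> 'rV[R]_m),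
        {within D, continuous (fun x => (L x, h x))} /\
        forall x, D x ->
          [/\ (edist_inf Lam (L x) <= (rho delta)%:E)%E,
              enorm (h x) <= delta * rho delta &
              F x (y0 + (x - x0) *m L x + h x)]].

(* Only the restrictions of chart_fun to chart_dom and of chart_inv to the
   image of chart_dom are meaningful. *)
Record chart (R : realType) (p : nat) (X : topologicalType) := Chart {
  chart_dom : set X;
  chart_fun :> X -> 'rV[R]_p;
  chart_inv : 'rV[R]_p -> X;
  chart_dom_open : open chart_dom;
  chart_codom_open : open (chart_fun @` chart_dom);
  chart_funK : forall x, chart_dom x -> chart_inv (chart_fun x) = x;
  chart_fun_continuous : {within chart_dom, continuous chart_fun};
  chart_inv_continuous :
    {within chart_fun @` chart_dom, continuous chart_inv} }.

Definition transition (R : realType) (p : nat) (X : topologicalType)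
  (c c' : chart R p X) : 'rV[R]_p -> 'rV[R]_p := c' \o chart_inv c.

(* D is meant to be open, so that continuity of the derivative on D is
   continuity at each point of D. *)
Definition C1_on (R : realType) (p q : nat) (D : set 'rV[R]_p)
    (f : 'rV[R]_p -> 'rV[R]_q) : Prop :=
  forall u, D u -> differentiable f u /\ {for u, continuous (jacobian f)}.

Definition C1_compatible (R : realType) (p : nat) (X : topologicalType)
    (c c' : chart R p X) : Prop :=
  C1_on (c @` (chart_dom c `&` chart_dom c')) (transition c c') /\
  C1_on (c' @` (chart_dom c `&` chart_dom c')) (transition c' c).

HB.mixin Record isC1Manifold (R : realType) (p : nat) X of Topological X := {
  manifold_hausdorff : hausdorff_space X;
  manifold_second_countable : @second_countable X;
  (* the maximal atlas *)
  atlas : set (chart R p X);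
  atlas_cover : forall x : X, exists2 c, atlas c & chart_dom c x;
  atlas_compatible :
    forall c c', atlas c -> atlas c' -> C1_compatible c c';
  atlas_maximal :
    forall c, (forall c', atlas c' -> C1_compatible c c') -> atlas c }.

#[short(type="c1ManifoldType")]
HB.structure Definition C1Manifold (R : realType) (p : nat) :=
  { X of isC1Manifold R p X & Topological X }.

Arguments atlas {R p} s.

Lemma near_eq_diff (R : realType) (V W : normedModType R) (f g : V -> W)
    (a : V) :
  (\forall u \near a, f u = g u) -> differentiable f a ->
  'd g a = 'd f a :> (V -> W).
Proof.
move=> fg df; apply/diff_unique; first exact: diff_continuous.
apply/eqaddoP => e e0.
have fa : f a = g a := nbhs_singleton fg.
have /eqaddoP/(_ e e0) := diff_locally df.
have fg0 : \forall h \near (0 : V), f (h + a) = g (h + a).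
  by move: fg; rewrite (near_shift 0 a) subr0; apply: filterS => h /=.
by apply: filterS2 fg0 => h; rewrite !fctE /= fa => ->.
Qed.

Lemma near_eq_diff_comp (R : realType) (U V W : normedModType R)
    (f : U -> V) (g : V -> W) (k : U -> W) (a : U) (b : V) (w : U) :
  f a = b -> differentiable f a -> differentiable g b ->
  (\forall u \near a, g (f u) = k u) -> 'd k a w = 'd g b ('d f a w).
Proof.
move=> fab df; case: b / fab => dg gfk.
have dgf : differentiable (g \o f) a by exact: differentiable_comp.
have := near_eq_diff (f := g \o f) gfk dgf.
rewrite (diff_comp df dg) => e; exact: (congr1 (fun F : U -> W => F w) e).
Qed.

Section Tangent.
Variables (R : realType) (p : nat) (X : c1ManifoldType R p) (x : X).

Record chart_at := ChartAt {
  chart_of_chart_at :> chart R p X;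
  chart_at_atlas : atlas X chart_of_chart_at;
  chart_at_dom : chart_dom chart_of_chart_at x }.

(* A tangent vector at x is the family of its coordinate vectors in all the
   charts around x, related by the derivatives of the transition maps. *)
Definition tangent_pred : {pred chart_at -> 'rV[R]_p} :=
  [pred v : chart_at -> 'rV[R]_p |
    `[< forall c c' : chart_at, v c' = 'd (transition c c') (c x) (v c) >]].

Lemma tangent_submod_closed : submod_closed tangent_pred.
Proof.
split=> [|a u v /asboolP hu /asboolP hv].
  by apply/asboolP => c c'; rewrite linear0.
by apply/asboolP => c c'; rewrite linearP [LHS]/= -hu -hv.
Qed.

HB.instance Definition _ := GRing.isSubmodClosed.Build R
  (chart_at -> 'rV[R]_p) tangent_pred tangent_submod_closed.

Record tangent := Tangent {
  tangent_val : chart_at -> 'rV[R]_p;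
  tangent_valP : tangent_val \in tangent_pred }.

HB.instance Definition _ := [isSub for tangent_val].
HB.instance Definition _ := [Choice of tangent by <:].
HB.instance Definition _ := [SubChoice_isSubLmodule of tangent by <:].

Definition dchart (c : chart_at) (v : tangent) : 'rV[R]_p := tangent_val v c.

Lemma dchart_is_linear (c : chart_at) : linear (dchart c).
Proof. by []. Qed.

HB.instance Definition _ (c : chart_at) :=
  GRing.isLinear.Build R tangent 'rV[R]_p *:%R (dchart c) (dchart_is_linear c).

Lemma chart_at_transitionP (a b : chart_at) :
  [/\ differentiable (transition a b) (a x),
      transition a b (a x) = b x &
      \forall u \near a x,
        chart_dom a (chart_inv a u) /\ chart_dom b (chart_inv a u)].
Proof.
have hax := chart_at_dom a; have hbx := chart_at_dom b.
split.
- have [H _] := atlas_compatible a b (chart_at_atlas a) (chart_at_atlas b).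
  by have [|] := H (a x); first by exists x.
- by rewrite /transition /= chart_funK.
have oA := @chart_codom_open _ _ _ a.
have nA : nbhs (a x) (a @` chart_dom a).
  by apply: open_nbhs_nbhs; split=> //; exists x.
have cA : {for a x, continuous (chart_inv a)}.
  have := @chart_inv_continuous _ _ _ a.
  by rewrite continuous_open_subspace// => /(_ (a x)); apply; rewrite inE; exists x.
have nB : nbhs (chart_inv a (a x)) (chart_dom b).
  rewrite chart_funK//; apply: open_nbhs_nbhs; split=> //.
  exact: chart_dom_open.
have nB' : nbhs (a x) (chart_inv a @^-1` chart_dom b) := cA _ nB.
by apply: filterS2 nA nB' => u [y ya <-] /=; rewrite chart_funK.
Qed.

Lemma transition_cocycle (a b c : chart_at) (w : 'rV[R]_p) :
  'd (transition a c) (a x) w =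
  'd (transition b c) (b x) ('d (transition a b) (a x) w).
Proof.
have [dab abx nab] := chart_at_transitionP a b.
have [dbc bcx _] := chart_at_transitionP b c.
apply: near_eq_diff_comp abx dab dbc _.
by apply: filterS nab => u [_ ub]; rewrite /transition /= chart_funK.
Qed.

Lemma dchart_inv_subproof (c : chart_at) (w : 'rV[R]_p) :
  (fun c' : chart_at => 'd (transition c c') (c x) w) \in tangent_pred.
Proof. by apply/asboolP => a b; exact: transition_cocycle. Qed.

Definition dchart_inv (c : chart_at) (w : 'rV[R]_p) : tangent :=
  Tangent (dchart_inv_subproof c w).

Lemma dchartK (c : chart_at) : cancel (dchart c) (dchart_inv c).
Proof.
move=> v; apply: val_inj; apply/funext => c' /=.
by rewrite [RHS](asboolP _ (tangent_valP v) c).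
Qed.

Lemma dchart_invK (c : chart_at) : cancel (dchart_inv c) (dchart c).
Proof.
move=> w; rewrite /dchart /=.
have ei : 'd (transition c c) (c x) = id :> ('rV[R]_p -> 'rV[R]_p).
  have [did eid] := is_diff_id (c x).
  apply: etrans eid; apply: near_eq_diff; last exact: did.
  have nA : nbhs (c x) (c @` chart_dom c).
    apply: open_nbhs_nbhs; split; first exact: chart_codom_open.
    by exists x => //; exact: chart_at_dom.
  by apply: filterS nA => u [y yc <-]; rewrite /transition /= chart_funK.
exact: (congr1 (fun F : 'rV[R]_p -> 'rV[R]_p => F w) ei).
Qed.

End Tangent.

(* psi \o F \o phi^-1; only its values on phi @` chart_dom phi are used. *)
Definition chart_setmap (R : realType) (p q : nat) (X Y : topologicalType)
    (phi : chart R p X) (psi : chart R q Y) (F : X -> set Y) :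
    'rV[R]_p -> set 'rV[R]_q :=
  fun u => psi @` (F (chart_inv phi u) `&` chart_dom psi).

(* The matrix of D psi(y) \o L \o D phi^-1(phi x). *)
Definition chart_linmx (R : realType) (p q : nat)
    (X : c1ManifoldType R p) (Y : c1ManifoldType R q) (x : X) (y : Y)
    (phi : chart_at x) (psi : chart_at y) (L : {linear tangent x -> tangent y}) :
    'M[R]_(p, q) :=
  lin1_mx (dchart psi \o L \o dchart_inv phi).

(* Compactness of Lam is the compactness of its matrix representation required
   by [QDQ]: the linear bijection [chart_linmx phi psi] is a homeomorphism for
   the vector space topology of Lin(T_x X, T_y Y). Since the notion does not
   depend on the charts nor on the extension Ghat of the coordinate expression
   of G, it is required for some choice of them. *)
Definition manifold_QDQ (R : realType) (p q : nat)
    (X : c1ManifoldType R p) (Y : c1ManifoldType R q)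
    (G : X -> set Y) (x : X) (y : Y)
    (Lam : set {linear tangent x -> tangent y}) (Gam : set X) : Prop :=
  exists (phi : chart_at x) (psi : chart_at y)
         (Ghat : 'rV[R]_p -> set 'rV[R]_q),
    [/\ phi x = 0, psi y = 0,
        forall u, (phi @` chart_dom phi) u -> Ghat u = chart_setmap phi psi G u &
        QDQ Ghat 0 0 (chart_linmx phi psi @` Lam)
          (phi @` (Gam `&` chart_dom phi))].

(* Main.v *)
Require Import Defs.
From HB Require Import structures.
From mathcomp Require Import all_boot all_order all_algebra.
From mathcomp Require Import all_classical all_reals all_analysis.
From mathcomp Require Import lra.

Set Implicit Arguments.
Unset Strict Implicit.
Unset Printing Implicit Defensive.

Import Order.TTheory GRing.Theory Num.Theory.
Import numFieldNormedType.Exports.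

Local Open Scope classical_set_scope.
Local Open Scope ring_scope.

(** The modulus in the definition of a QDQ can be eliminated: [Lam] is a QDQ
    exactly when it is compact and, for every eps > 0 and all small enough
    delta, there are continuous [L] and [h] on the delta-ball with [L] within
    eps of [Lam] and h bounded by eps * delta ([QDQ_approxP]). In this form the
    chain rule between Euclidean spaces ([QDQ_comp]) is a substitution. If
    (L1, h1) approximates F on the delta-ball, the selection
    y(x) = y0 + (x - x0) L1(x) + h1(x) is continuous and stays in a ball of
    radius K delta, where K depends only on the dimensions and on a bound of the
    compact set LamF; it takes its values in the direction GamG by the
    inclusion hypothesis, so the approximation (L2, h2) of G on the K delta-ball
    can be evaluated along it, and
      z0 + (y(x) - y0) L2(y(x)) + h2(y(x))
        = z0 + (x - x0) (L1(x) L2(y(x))) + (h1(x) L2(y(x)) + h2(y(x))).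

    On manifolds, the chart c of the middle manifold used for F need not be the
    chart c' used for G. The transition map from c to c' is differentiable, and
    as a single-valued map near the base point it has its Jacobian as a QDQ
    ([QDQ_differentiable]). Applying the Euclidean chain rule twice, to F in the
    charts phi and c, the transition map, and G in the charts c' and psi, gives
    a QDQ of a submap of the coordinate expression of the composition; enlarging
    the map preserves the property ([QDQ_mono]). The three matrices multiply to
    the matrix of the composed linear map because a tangent vector changes
    coordinates by the Jacobian of the transition map ([chart_linmx_comp]). *)

(** * Matrix norms, limits of matrix products, distance to a set *)

Section Norms.
Context {R : realType}.

Lemma entry_le_norm (m n : nat) (A : 'M[R]_(m, n)) i j : `|A i j| <= `|A|.
Proof.
rewrite [leRHS]/Num.norm /= mx_normrE.
exact: (le_bigmax 0 (fun ij : 'I_m * 'I_n => `|A ij.1 ij.2|) (i, j)).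
Qed.

Lemma norm_mx_le (m n : nat) (A : 'M[R]_(m, n)) (r : R) :
  0 <= r -> (forall i j, `|A i j| <= r) -> `|A| <= r.
Proof.
move=> r0 Ar; rewrite [leLHS]/Num.norm /= mx_normrE.
by apply/bigmax_leP; split=> // -[i j] _; exact: Ar.
Qed.

Lemma norm_mulmx (m n p : nat) (A : 'M[R]_(m, n)) (B : 'M[R]_(n, p)) :
  `|A *m B| <= n%:R * `|A| * `|B|.
Proof.
apply: norm_mx_le => [|i j]; first by rewrite !mulr_ge0.
rewrite mxE (le_trans (ler_norm_sum _ _ _))//.
have -> : n%:R * `|A| * `|B| = \sum_(k < n) `|A| * `|B|.
  by rewrite sumr_const card_ord -mulrA mulr_natl.
by apply: ler_sum => k _; rewrite normrM ler_pM// entry_le_norm.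
Qed.

Lemma norm_le_enorm (n : nat) (u : 'rV[R]_n) : `|u| <= enorm u.
Proof.
apply: norm_mx_le => [|i j]; first exact: sqrtr_ge0.
rewrite ord1 -sqrtr_sqr ler_wsqrtr// (bigD1 j)//= lerDl sumr_ge0// => k _.
exact: sqr_ge0.
Qed.

Lemma enorm_le_norm (n : nat) (u : 'rV[R]_n) : enorm u <= n%:R * `|u|.
Proof.
have nu0 : 0 <= n%:R * `|u| by rewrite mulr_ge0.
rewrite -[leRHS]ger0_norm// -sqrtr_sqr ler_wsqrtr//.
have -> : (n%:R * `|u|) ^+ 2 = n%:R * \sum_(i < n) `|u| ^+ 2.
  by rewrite sumr_const card_ord exprMn -[X in _ = _ * X]mulr_natl mulrA expr2.
have sum_le : \sum_(i < n) u 0 i ^+ 2 <= \sum_(i < n) `|u| ^+ 2.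
  apply: ler_sum => i _.
  by rewrite -real_normK ?num_real// lerXn2r ?nnegrE// entry_le_norm.
apply: le_trans sum_le _; case: n {nu0} u => [|n] u.
  by rewrite big_ord0 mulr0.
by rewrite ler_peMl ?ler1n// sumr_ge0.
Qed.

Lemma cvg_mulmx (T : Type) (F : set_system T) {FF : Filter F} (m n p : nat)
    (f : T -> 'M[R]_(m, n)) (g : T -> 'M[R]_(n, p))
    (A : 'M[R]_(m, n)) (B : 'M[R]_(n, p)) :
  f x @[x --> F] --> A -> g x @[x --> F] --> B ->
  f x *m g x @[x --> F] --> A *m B.
Proof.
move=> fA gB; apply/subr_cvg0/norm_cvg0P.
have fA0 : `|f x - A| @[x --> F] --> 0 by apply/norm_cvg0P/subr_cvg0.
have gB0 : `|g x - B| @[x --> F] --> 0 by apply/norm_cvg0P/subr_cvg0.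
pose b x := n%:R * (`|f x - A| * `|g x| + `|A| * `|g x - B|).
apply: (@squeeze_cvgr _ _ _ _ (fun=> 0) b); last 2 first.
- exact: cvg_cst.
- have -> : 0 = n%:R * (0 * `|B| + `|A| * 0) :> R.
    by rewrite mul0r mulr0 addr0 mulr0.
  apply: cvgM; first exact: cvg_cst.
  by apply: cvgD; apply: cvgM => //; [exact: cvg_norm|exact: cvg_cst].
apply: nearW => x; rewrite normr_ge0/=.
have -> : f x *m g x - A *m B = (f x - A) *m g x + A *m (g x - B).
  by rewrite mulmxBl mulmxBr addrA subrK.
rewrite (le_trans (ler_normD _ _))// /b mulrDr !mulrA lerD//; exact: norm_mulmx.
Qed.

Lemma compact_norm_ub (V : normedModType R) (A : set V) :
  compact A -> exists2 C : R, 0 <= C & forall a, A a -> `|a| <= C.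
Proof.
move=> /compact_bounded[C [_ AC]]; exists (`|C| + 1); first by rewrite addr_ge0.
by move=> a Aa; apply: AC => //; rewrite (le_lt_trans (ler_norm C))// ltrDl.
Qed.

Lemma edist_inf_le (V : normedModType R) (A : set V) x a (r : R) :
  A a -> `|x - a| < r -> (edist_inf A x <= r%:E)%E.
Proof.
move=> Aa xar; apply: ge_ereal_inf; exists (edist (x, a)); first by exists a.
apply: edist_fin; first exact: le_lt_trans xar.
by rewrite -ball_normE.
Qed.

Lemma edist_inf_lt (V : normedModType R) (A : set V) x (r : R) :
  (edist_inf A x < r%:E)%E -> exists2 a, A a & `|x - a| < r.
Proof.
move=> /ereal_inf_lt[_ [a Aa <-]] /edist_lt_ball /= xa; exists a => //.
by move: xa; rewrite -ball_normE.
Qed.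

Lemma near_right0P (P : R -> Prop) :
  (\forall d \near 0^'+, P d) <->
  exists2 r, 0 < r & forall d, 0 < d -> d < r -> P d.
Proof.
split=> [/nbhs_ballP[r /= r0 rP]|[r r0 rP]].
  exists r => // d d0 dr; apply: rP => //.
  by rewrite /ball/= sub0r normrN gtr0_norm.
near=> d; apply: rP; first by near: d; exact: nbhs_right_gt.
by near: d; exact: nbhs_right_lt.
Unshelve. all: by end_near. Qed.

End Norms.

(** * Quasi differential quotients without moduli *)

Section QDQ_eps.
Context {R : realType} {n m : nat}.
Implicit Types (F : 'rV[R]_n -> set 'rV[R]_m) (Lam : set 'M[R]_(n, m)).

(** The distance condition asks for an approximating element of [Lam], so an
    empty [Lam] forces an empty domain [D], in agreement with the infinite
    distance to the empty set. *)
Definition QDQ_approx F x0 y0 Lam Gam (eps delta : R) : Prop :=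
  let D := [set x | enorm (x - x0) < delta] `&` Gam in
  exists (L : 'rV[R]_n -> 'M[R]_(n, m)) (h : 'rV[R]_n -> 'rV[R]_m),
    {within D, continuous (fun x => (L x, h x))} /\
    forall x, D x ->
      [/\ exists2 A, Lam A & `|L x - A| <= eps,
          `|h x| <= eps * delta &
          F x (y0 + (x - x0) *m L x + h x)].

Lemma QDQ_approx_le F x0 y0 Lam Gam (e e' d : R) :
  e <= e' -> 0 < d ->
  QDQ_approx F x0 y0 Lam Gam e d -> QDQ_approx F x0 y0 Lam Gam e' d.
Proof.
move=> ee' d0 [L [h [Lh DLh]]]; exists L, h; split=> // x /DLh[[A LA Ae] he Fx].
split=> //; first by exists A => //; exact: le_trans ee'.
by rewrite (le_trans he)// ler_pM2r.
Qed.

(** From right to left, the modulus is rho(delta) = c (r(delta) + delta),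
    where r(delta) is the infimum of the eps that are admissible at all scales
    up to delta. This infimum is monotone because more scales leave fewer eps;
    adding delta > 0 lets the infimum be approached from above, and the factor c
    compares the Euclidean norm with the max norm. *)
Lemma QDQ_approxP F x0 y0 Lam Gam :
  QDQ F x0 y0 Lam Gam <->
  compact Lam /\ forall eps, 0 < eps ->
    \forall delta \near 0^'+, QDQ_approx F x0 y0 Lam Gam eps delta.
Proof.
split=> [[cLam [ds [rho [ds0 [rho0 _ rhoc] H]]]]|[cLam H]]; split=> //.
  move=> e e0; near=> d.
  have d0 : 0 < d by near: d; exact: nbhs_right_gt.
  have dds : (d%:E < ds)%E.
    near: d; case: ds ds0 {H} => [r| |//] r0; last first.
      by apply: nearW => d; rewrite ltry.
    by apply: filterS (nbhs_right_lt r0) => d; rewrite lte_fin.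
  have re : rho d < e by near: d; exact: (cvgr_lt 0 rhoc).
  have [L [h [Lh DLh]]] := H d d0 dds.
  exists L, h; split=> // x /DLh[Lx hx Fx]; split=> //.
    have [|A LA LxA] := @edist_inf_lt _ _ Lam (L x) e.
      by apply: le_lt_trans Lx _; rewrite lte_fin.
    by exists A => //; exact: ltW.
  rewrite (le_trans (norm_le_enorm _))// (le_trans hx)// mulrC ler_pM2r//.
  exact: ltW.
(* Every eps >= 1 is put in [E d], so that [E d] is never empty and its infimum
   is at most 1 even at scales where nothing is known. *)
pose P := QDQ_approx F x0 y0 Lam Gam.
pose E d := [set e : R |
  0 < e /\ (1 <= e \/ forall d', 0 < d' -> d' <= d -> P e d')].
pose c : R := m.+1%:R.
have c1 : 1 <= c by rewrite /c ler1n.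
have c0 : 0 < c by exact: lt_le_trans c1.
have E1 d : E d 1 by split; [|left].
have Elb d : lbound (E d) 0 by move=> e [/ltW].
have Einf d : has_inf (E d) by split; [exists 1|exists 0].
have infE0 d : 0 <= inf (E d) by apply: lb_le_inf => //; exists 1.
have /near_right0P[r1 r10 Hr1] := H 1 ltr01.
(* Below the scale [r1] eps = 1 is admissible, and so is every eps >= 1. *)
exists r1%:E, (fun d => c * (inf (E d) + d)); split=> //.
- split=> [s s0|s t s0 st|]; first by rewrite mulr_ge0 ?addr_ge0// ltW.
    rewrite ler_pM2l// lerD//; apply: lb_le_inf; first by exists 1.
    move=> e [e0 He]; apply: ge_inf; first by exists 0.
    split=> //; case: He => [?|He]; [by left|right=> d' d'0 d's].
    by apply: He => //; exact: le_trans st.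
  have infc : inf (E d) @[d --> 0^'+] --> (0 : R).
    apply/cvgr0Pnorm_le => e e0; have /near_right0P[r r0 Hr] := H e e0.
    apply/near_right0P; exists r => // d d0 dr; rewrite ger0_norm//.
    apply: ge_inf; first by exists 0.
    by split=> //; right=> d' d'0 d'd; apply: Hr => //; exact: le_lt_trans dr.
  have idc : d @[d --> 0^'+] --> (0 : R) by exact: cvg_within.
  have := cvgM (cvg_cst c) (cvgD infc idc).
  by rewrite addr0 mulr0; apply.
move=> d d0; rewrite lte_fin => dr1 /=.
have [e [e0 He] einf] := inf_adherent d0 (Einf d).
have [L [h [Lh DLh]]] : P e d.
  case: He => [e1|]; last by apply.
  exact: QDQ_approx_le e1 d0 (Hr1 d d0 dr1).
exists L, h; split=> // x /DLh[[A LA LxA] hx Fx]; split=> //.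
  apply: (@edist_inf_le _ _ _ _ A) => //; apply: le_lt_trans LxA _.
  by rewrite (lt_le_trans einf)// ler_peMl// addr_ge0// ltW.
rewrite (le_trans (enorm_le_norm _))// mulrCA ler_pM//.
  by rewrite /c ler_nat.
by rewrite (le_trans hx)// mulrC ler_pM2l// ltW.
Unshelve. all: by end_near. Qed.

End QDQ_eps.

(** * Chain rule between Euclidean spaces *)

Lemma within_continuous_comp (T U V : topologicalType) (A : set T) (B : set U)
    (f : T -> U) (g : U -> V) :
  (forall x, A x -> B (f x)) ->
  {within A, continuous f} -> {within B, continuous g} ->
  {within A, continuous (g \o f)}.
Proof.
move=> AB /subspace_continuousP fA /subspace_continuousP gB.
apply/subspace_continuousP => x Ax; apply: cvg_trans (gB _ (AB x Ax)) => W.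
move=> /= /(fA x Ax); rewrite /nbhs /= /within /=.
by apply: filterS => y fy Ay; apply: (fy Ay); exact: AB.
Qed.

Section Euclidean.
Context {R : realType}.

Lemma QDQ_mono (n m : nat) (F F' : 'rV[R]_n -> set 'rV[R]_m) x0 y0 Lam Gam :
  (forall x, Gam x -> F x `<=` F' x) ->
  QDQ F x0 y0 Lam Gam -> QDQ F' x0 y0 Lam Gam.
Proof.
move=> FF' [cLam [ds [rho [ds0 mrho H]]]]; split=> //; exists ds, rho.
split=> // d d0 dds; have [L [h [Lh DLh]]] := H d d0 dds; exists L, h.
split=> // x [xd Gx]; have [Lx hx Fx] := DLh x (conj xd Gx); split=> //.
exact: FF'.
Qed.

(** With the constant matrix of the derivative for [L], the error [h] is the
    remainder of the first-order expansion, which is o(delta) on the delta-ball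
    and continuous where [f] is. The graph is cut down to [V] because a
    transition map between charts is meaningful only near the base point. *)
Lemma QDQ_differentiable (n m : nat) (f : 'rV[R]_n -> 'rV[R]_m)
    (x0 : 'rV[R]_n) (V Gam : set 'rV[R]_n) :
  differentiable f x0 -> nbhs x0 V ->
  (forall x, V x -> {for x, continuous f}) ->
  QDQ (fun x => [set y | V x /\ f x = y]) x0 (f x0) [set jacobian f x0] Gam.
Proof.
move=> df x0V cf; apply/QDQ_approxP; split; first exact: compact_set1.
move=> e e0; pose J := jacobian f x0.
have /eqaddoP/(_ e e0) := diff_locally df.
have V0 : \forall h \near (0 : 'rV[R]_n), V (h + x0).
  have : \forall x \near x0, V x by [].
  by rewrite (near_shift 0 x0) subr0.
move=> fo; have [r /= r0 rP] := (nbhs_ballP _ _).1 (filterI V0 fo).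
apply/near_right0P; exists r => // d d0 dr.
have DP x : ([set x | enorm (x - x0) < d] `&` Gam) x ->
    V x /\ `|f x - f x0 - (x - x0) *m J| <= e * `|x - x0|.
  move=> [/= xd _]; have [] := rP (x - x0).
    rewrite -ball_normE/= sub0r normrN (lt_trans _ dr)//.
    exact: le_lt_trans (norm_le_enorm _) xd.
  by rewrite /= !fctE /= subrK opprD addrA mul_rV_lin1.
exists (fun=> J), (fun x => f x - f x0 - (x - x0) *m J); split.
  apply/subspace_continuousP => x Dx; have [Vx _] := DP x Dx.
  apply: cvg_within_filter.
  have cJ : (z - x0) *m J @[z --> x] --> (x - x0) *m J.
    exact: (cvg_mulmx (cvgB cvg_id (cvg_cst x0)) (cvg_cst J)).
  exact: (cvg_pair (cvg_cst J) (cvgB (cvgB (cf x Vx) (cvg_cst (f x0))) cJ)).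
move=> x Dx; have [Vx le_e] := DP x Dx; split.
- by exists J => //; rewrite subrr normr0 ltW.
- rewrite (le_trans le_e)// ler_pM2l//; case: Dx => /= /ltW xd _.
  exact: le_trans (norm_le_enorm _) xd.
- by split=> //; rewrite [RHS]addrC -[X in X + _]addrA -opprD subrK.
Qed.

Lemma QDQ_comp (n m l : nat) (F : 'rV[R]_n -> set 'rV[R]_m)
    (G : 'rV[R]_m -> set 'rV[R]_l) x0 y0 z0 LamF LamG
    (GamF : set 'rV[R]_n) (GamG : set 'rV[R]_m) :
  (forall x, GamF x -> F x `<=` GamG) ->
  QDQ F x0 y0 LamF GamF -> QDQ G y0 z0 LamG GamG ->
  QDQ (fun x => \bigcup_(y in F x) G y) x0 z0
    [set A *m B | A in LamF & B in LamG] GamF.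
Proof.
move=> FG /QDQ_approxP[cF HF] /QDQ_approxP[cG HG]; apply/QDQ_approxP; split.
  have -> : [set A *m B | A in LamF & B in LamG] =
            (fun AB => AB.1 *m AB.2) @` (LamF `*` LamG).
    apply/seteqP; split=> [_ [A LA [B LB <-]]|_ [[A B] [/= LA LB] <-]].
      by exists (A, B).
    by exists A => //; exists B.
  apply: continuous_compact; last exact: compact_setX.
  apply: continuous_subspaceT => AB.
  by apply: cvg_mulmx; [exact: cvg_fst|exact: cvg_snd].
move=> e e0.
have [C1 C10 LC1] := compact_norm_ub cF.
have [C2 C20 LC2] := compact_norm_ub cG.
(* y(x) - y0 is (x - x0) *m L1 x + h1 x, with L1 x bounded by C1 + 1, so it has
   max norm at most (n (C1 + 1) + 1) delta; the factor m bounds the Euclidean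
   norm by the max norm, and the last 1 makes the inequality with K delta
   strict. *)
pose K : R := m%:R * (n%:R * (C1 + 1) + 1) + 1.
have K0 : 0 < K by rewrite ltr_wpDl// !(mulr_ge0, addr_ge0).
(* e1 * B bounds both the distance of L1 x *m L2 (y x) to the product set and
   the ratio of the new error to delta. *)
pose B : R := m%:R * (C2 + 1) + m%:R * C1 + K.
have B0 : 0 < B by rewrite ltr_wpDl// !(addr_ge0, mulr_ge0).
pose e1 := Num.min 1 (e / B).
have e10 : 0 < e1 by rewrite lt_min ltr01 divr_gt0.
have e11 : e1 <= 1 by rewrite ge_min lexx.
have e1B : e1 * B <= e by rewrite -ler_pdivlMr// ge_min lexx orbT.
have /near_right0P[r1 r10 HF1] := HF e1 e10.
have /near_right0P[r2 r20 HG1] := HG e1 e10.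
apply/near_right0P; exists (Num.min r1 (r2 / K)).
  by rewrite lt_min r10 divr_gt0.
move=> d d0; rewrite lt_min => /andP[dr1]; rewrite ltr_pdivlMr// mulrC => dr2.
have [L1 [h1 [Lh1 DLh1]]] := HF1 d d0 dr1.
have [L2 [h2 [Lh2 DLh2]]] := HG1 (K * d) (mulr_gt0 K0 d0) dr2.
pose y x := y0 + (x - x0) *m L1 x + h1 x.
set D1 := _ `&` GamF in Lh1 DLh1; set D2 := _ `&` GamG in Lh2 DLh2.
have yB x : y x - y0 = (x - x0) *m L1 x + h1 x.
  by apply: (addrI y0); rewrite addrC subrK addrA.
have yD x : D1 x -> D2 (y x).
  move=> Dx; have [[A LA LxA] hx Fx] := DLh1 x Dx.
  case: Dx => /= xd Gx; split; last exact: FG Fx.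
  have L1x : `|L1 x| <= C1 + 1.
    rewrite -[L1 x](subrK A) addrC (le_trans (ler_normD _ _))// lerD//.
      exact: LC1.
    exact: le_trans LxA _.
  have xL1 : `|(x - x0) *m L1 x| <= n%:R * (C1 + 1) * d.
    rewrite (le_trans (norm_mulmx _ _))// mulrAC ler_pM ?mulr_ge0//.
      by rewrite ler_wpM2l.
    exact: le_trans (norm_le_enorm _) (ltW xd).
  rewrite /= yB.
  rewrite (le_lt_trans (enorm_le_norm _))//.
  have : `|(x - x0) *m L1 x + h1 x| <= (n%:R * (C1 + 1) + 1) * d.
    rewrite (le_trans (ler_normD _ _))// mulrDl lerD// mul1r.
    by rewrite (le_trans hx)// ler_piMl// ltW.
  move=> /(ler_wpM2l (ler0n R m)) /le_lt_trans; apply.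
  by rewrite mulrA ltr_pM2r// ltrDl.
have cy : {within D1, continuous y}.
  apply/subspace_continuousP => x Dx.
  have /subspace_continuousP/(_ x Dx) Lhx := Lh1.
  apply: cvgD; last exact: cvg_comp Lhx cvg_snd.
  apply: cvgD; first exact: cvg_cst.
  apply: cvg_mulmx; last exact: cvg_comp Lhx cvg_fst.
  by apply: cvgB; [exact: cvg_within|exact: cvg_cst].
exists (fun x => L1 x *m L2 (y x)), (fun x => h1 x *m L2 (y x) + h2 (y x)).
split.
  have := within_continuous_comp yD cy Lh2.
  move=> /subspace_continuousP Lh2y.
  apply/subspace_continuousP => x Dx; have Lh2x := Lh2y x Dx.
  have /subspace_continuousP/(_ x Dx) Lhx := Lh1.
  have cL1 : L1 z @[z --> within D1 (nbhs x)] --> L1 x.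
    exact: cvg_comp Lhx cvg_fst.
  have ch1 : h1 z @[z --> within D1 (nbhs x)] --> h1 x.
    exact: cvg_comp Lhx cvg_snd.
  have cL2 : L2 (y z) @[z --> within D1 (nbhs x)] --> L2 (y x).
    exact: cvg_comp Lh2x cvg_fst.
  have ch2 : h2 (y z) @[z --> within D1 (nbhs x)] --> h2 (y x).
    exact: cvg_comp Lh2x cvg_snd.
  exact: (cvg_pair (cvg_mulmx cL1 cL2) (cvgD (cvg_mulmx ch1 cL2) ch2)).
move=> x Dx; have [[A1 LA1 LxA1] hx1 Fx] := DLh1 x Dx.
have [[A2 LA2 LxA2] hx2 Gx] := DLh2 (y x) (yD x Dx).
have L2x : `|L2 (y x)| <= C2 + 1.
  rewrite -[L2 _](subrK A2) addrC (le_trans (ler_normD _ _))// lerD//.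
    exact: LC2.
  exact: le_trans LxA2 _.
split.
- exists (A1 *m A2); first by exists A1 => //; exists A2.
  have -> : L1 x *m L2 (y x) - A1 *m A2 =
            (L1 x - A1) *m L2 (y x) + A1 *m (L2 (y x) - A2).
    by rewrite mulmxBl mulmxBr addrA subrK.
  rewrite (le_trans _ e1B)// (le_trans (ler_normD _ _))//.
  apply: (@le_trans _ _ (m%:R * e1 * (C2 + 1) + m%:R * C1 * e1)).
    rewrite lerD// (le_trans (norm_mulmx _ _))// ler_pM// ?mulr_ge0//.
      by rewrite ler_wpM2l.
    by rewrite ler_wpM2l// LC1.
  rewrite /B; nra.
- rewrite (le_trans (ler_normD _ _))//.
  apply: (@le_trans _ _ (m%:R * (e1 * d) * (C2 + 1) + e1 * (K * d))).
    rewrite lerD// (le_trans (norm_mulmx _ _))// ler_pM// ?mulr_ge0//.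
    by rewrite ler_wpM2l.
  apply: (@le_trans _ _ (e1 * B * d)); last by rewrite ler_pM2r.
  rewrite /B; have : 0 <= e1 * d * (m%:R * C1) by rewrite !mulr_ge0// ltW.
  lra.
- exists (y x) => //; suff -> : z0 + (x - x0) *m (L1 x *m L2 (y x)) +
    (h1 x *m L2 (y x) + h2 (y x)) =
    z0 + (y x - y0) *m L2 (y x) + h2 (y x) by [].
  by rewrite yB mulmxDl mulmxA !addrA.
Qed.

End Euclidean.

(** * Composition of linear maps in charts *)

Section Charts.
Context {R : realType}.

Lemma dchart_inv_is_linear (p : nat) (X : c1ManifoldType R p) (x : X)
  (c : chart_at x) : linear (dchart_inv c).
Proof. exact: (can2_linear (@dchartK _ _ _ _ c) (@dchart_invK _ _ _ _ c)). Qed.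

HB.instance Definition _ (p : nat) (X : c1ManifoldType R p) (x : X)
    (c : chart_at x) :=
  GRing.isLinear.Build R 'rV[R]_p (tangent x) *:%R (dchart_inv c)
    (dchart_inv_is_linear c).

Lemma mul_chart_linmx (p q : nat) (X : c1ManifoldType R p)
    (Y : c1ManifoldType R q) (x : X) (y : Y) (phi : chart_at x)
    (psi : chart_at y) (L : {linear tangent x -> tangent y}) u :
  u *m chart_linmx phi psi L = dchart psi (L (dchart_inv phi u)).
Proof. by rewrite /chart_linmx mul_rV_lin1. Qed.

(** When the target chart [c] of [L1] differs from the source chart [c'] of
    [L2], the Jacobian of the transition map converts between the two coordinate
    vectors of a tangent vector at [y]. *)
Lemma chart_linmx_comp (p q r : nat) (X : c1ManifoldType R p)
    (Y : c1ManifoldType R q) (Z : c1ManifoldType R r) (x : X) (y : Y) (z : Z)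
    (phi : chart_at x) (c c' : chart_at y) (psi : chart_at z)
    (L1 : {linear tangent x -> tangent y})
    (L2 : {linear tangent y -> tangent z}) :
  chart_linmx phi psi (L2 \o L1 : {linear tangent x -> tangent z}) =
  chart_linmx phi c L1 *m jacobian (transition c c') (c y)
    *m chart_linmx c' psi L2.
Proof.
apply/row_matrixP => i; rewrite !rowE !mulmxA !mul_chart_linmx mul_rV_lin1 /=.
congr (dchart psi (L2 _)); apply: (can_inj (dchartK c')); rewrite dchart_invK.
set v := L1 _; by rewrite -[in LHS](dchartK c v).
Qed.

Lemma transition_continuous (p : nat) (X : c1ManifoldType R p) (x : X)
    (c c' : chart_at x) a :
  chart_dom c a -> chart_dom c' a -> {for c a, continuous (transition c c')}.
Proof.
move=> ca c'a.
have [H _] := atlas_compatible c c' (chart_at_atlas c) (chart_at_atlas c').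
by apply: differentiable_continuous; have [|] := H (c a); first by exists a.
Qed.

End Charts.

(** * Chain rule on manifolds *)

Theorem mainTheorem2 (R : realType) (m n l : nat)
    (N : c1ManifoldType R m) (M : c1ManifoldType R n) (L : c1ManifoldType R l)
    (F : N -> set M) (G : M -> set L)
    (xbar : N) (ybar : M) (zbar : L)
    (GamF : set N) (GamG : set M)
    (LamF : set {linear tangent xbar -> tangent ybar})
    (LamG : set {linear tangent ybar -> tangent zbar}) :
  manifold_QDQ F LamF GamF ->
  \bigcup_(x in GamF) F x `<=` GamG ->
  manifold_QDQ G LamG GamG ->
  manifold_QDQ (fun x => \bigcup_(y in F x) G y)
    [set (L2 \o L1 : {linear tangent xbar -> tangent zbar})
      | L2 in LamG & L1 in LamF]
    GamF.
Proof.
move=> [phi [c [Fhat [phi0 c0 FhatE QF]]]] FG.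
move=> [c' [psi [Ghat [c'0 psi0 GhatE QG]]]].
exists phi, psi, (chart_setmap phi psi (fun x => \bigcup_(y in F x) G y)).
split=> //.
pose T := transition c c'.
pose V := c @` (chart_dom c `&` chart_dom c').
have [dT Tc nearT] := chart_at_transitionP c c'.
have nV : nbhs (c ybar) V.
  have cdom : nbhs (c ybar) (c @` chart_dom c).
    apply: open_nbhs_nbhs; split; first exact: chart_codom_open.
    by exists ybar => //; exact: chart_at_dom.
  apply: filterS2 cdom nearT => _ [b cb <-]; rewrite chart_funK// => -[_ c'b].
  by exists b.
have cT u : V u -> {for u, continuous T}.
  by move=> [b [cb c'b] <-]; exact: transition_continuous.
have := QDQ_differentiable setT dT nV cT; rewrite Tc c0 c'0 => QT.
have QTF := QDQ_comp (fun _ _ _ _ => Logic.I) QF QT.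
(* Each transported value in T (Fhat u) is the c'-coordinate of a value of F,
   which lies in GamG by the inclusion hypothesis. *)
have TF u w : (phi @` (GamF `&` chart_dom phi)) u ->
    (\bigcup_(v in Fhat u) [set w | V v /\ T v = w]) w ->
    exists b, [/\ F (chart_inv phi u) b, GamG b, chart_dom c' b & c' b = w].
  move=> [a [Ga phia] <-] [v]; rewrite FhatE; last by exists a.
  rewrite /chart_setmap chart_funK//.
  move=> -[b [Fab cb] <-] [[b' [cb' c'b'] bb'] <-].
  have eb : b' = b by rewrite -(chart_funK cb') bb' chart_funK.
  rewrite eb in c'b'; exists b; split=> //; first by apply: FG; exists a.
  by rewrite /T /transition /= chart_funK.
have TFG u : (phi @` (GamF `&` chart_dom phi)) u ->
    \bigcup_(v in Fhat u) [set w | V v /\ T v = w] `<=`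
    c' @` (GamG `&` chart_dom c').
  by move=> Gu w /(TF u w Gu)[b [_ Gb c'b <-]]; exists b.
have QGTF := QDQ_comp TFG QTF QG.
have linE L1 L2 := chart_linmx_comp phi c c' psi L1 L2; rewrite c0 in linE.
have -> : chart_linmx phi psi @`
    [set (L2 \o L1 : {linear tangent xbar -> tangent zbar})
      | L2 in LamG & L1 in LamF] =
  [set A *m B | A in [set A *m B | A in chart_linmx phi c @` LamF
                                & B in [set jacobian T 0]]
              & B in chart_linmx c' psi @` LamG].
  apply/seteqP; split.
    move=> _ [_ [L2 GL2 [L1 FL1 <-]] <-]; rewrite linE.
    exists (chart_linmx phi c L1 *m jacobian T 0).
      by exists (chart_linmx phi c L1); [exists L1|exists (jacobian T 0)].
    by exists (chart_linmx c' psi L2) => //; exists L2.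
  move=> _ [_ [_ [L1 FL1 <-] [_ -> <-]] [_ [L2 GL2 <-] <-]].
  exists (L2 \o L1 : {linear tangent xbar -> tangent zbar}).
    by exists L2 => //; exists L1.
  exact: linE.
refine (QDQ_mono _ QGTF) => u Gu z [w /(TF u w Gu)[b [Fb _ c'b <-]]].
rewrite GhatE; last by exists b.
rewrite /chart_setmap chart_funK// => -[d [Gd psid] <-].
by exists d => //; split=> //; exists b.
Qed.
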